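(* Let $G_1$ be a graph without odd cycles and let $G_2$ be a non-trivial bounded graph without odd cycles. Then the direct product $G_1\times G_2$ is hyperbolic if and only if $G_1$ is hyperbolic.
   Context: Conventions. A graph $G$ (such as $G_1,G_2$) is a nonempty, connected, simple (no loops, no multiple edges), possibly infinite graph; every edge has length $1$, and $G$ is regarded as a geodesic metric space by identifying each edge isometrically with $[0,1]$ and using the shortest-path distance $d_G$ (so points of $G$ are vertices and interior points of edges). A graph is trivial if it has exactly one vertex, and bounded if it has finite diameter. A cycle is a simple closed curve (a closed path with no repeated vertices except first = last); it is odd if its length is odd. Direct product: $G_1\times G_2$ has vertex set $V(G_1)\times V(G_2)$, and $(u_1,v_1)$, $(u_2,v_2)$ are adjacent iff $[u_1,u_2]\in E(G_1)$ and $[v_1,v_2]\in E(G_2)$. It may be disconnected. Hyperbolicity: in a geodesic metric space $X$, a geodesic triangle is the union of three geodesics $[x_1x_2],[x_2x_3],[x_3x_1]$; it is $\delta$-thin if each side is contained in the $\delta$-neighborhood of the union of the other two sides. $\delta(T)$ is the infimum of $\delta\ge 0$ such that $T$ is $\delta$-thin, $\delta(X):=\sup_T\delta(T)$ over all geodesic triangles $T$ in $X$, and $X$ is hyperbolic if $\delta(X)<\infty$. If $X$ has connected components $X_i$, then $\delta(X):=\sup_i\delta(X_i)$, and $X$ is hyperbolic if $\delta(X)<\infty$. *)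

(* Defs.v *)
From HB Require Import structures.
From mathcomp Require Import all_boot all_order all_algebra.
From mathcomp Require Import all_classical all_reals all_analysis.

Set Implicit Arguments.
Unset Strict Implicit.
Unset Printing Implicit Defensive.

Import Order.TTheory GRing.Theory Num.Theory.

Local Open Scope classical_set_scope.
Local Open Scope ring_scope.

(* Simple graphs. Nonemptiness and connectedness are separate predicates,      *)
(* because a direct product of connected graphs may be disconnected.           *)
Record graph := Graph {
  vertex :> eqType;
  adj : rel vertex;
  adj_sym : symmetric adj;
  adj_irrefl : irreflexive adj }.

Definition nonempty_graph (G : graph) : Prop := exists v : G, True.

Definition connected_graph (G : graph) : Prop :=
  forall u v : G, exists p : seq G, path (@adj G) u p /\ last u p = v.

Definition trivial_graph (G : graph) : Prop :=
  exists v : G, forall w : G, w = v.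

(* c lists the vertices of the cycle once; its length is size c. *)
Definition is_cycle (G : graph) (c : seq G) : Prop :=
  (2 < size c)%N /\ ucycle (@adj G) c.

Definition no_odd_cycle (G : graph) : Prop :=
  forall c : seq G, is_cycle c -> ~~ odd (size c).

Definition dprod_adj (G1 G2 : graph) : rel (G1 * G2)%type :=
  fun p q => adj p.1 q.1 && adj p.2 q.2.

Lemma dprod_adj_sym (G1 G2 : graph) : symmetric (@dprod_adj G1 G2).
Proof. by move=> p q; rewrite /dprod_adj adj_sym (@adj_sym G2). Qed.

Lemma dprod_adj_irrefl (G1 G2 : graph) : irreflexive (@dprod_adj G1 G2).
Proof. by move=> p; rewrite /dprod_adj adj_irrefl. Qed.

Definition direct_product (G1 G2 : graph) : graph :=
  Graph (@dprod_adj_sym G1 G2) (@dprod_adj_irrefl G1 G2).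

(* Points of the metric graph are given by barycentric coordinates V(G) -> R:  *)
(* a vertex is the indicator of itself, and edge_pt u v t is the point at      *)
(* distance t from u on the edge [u, v].                                       *)
Definition vertex_pt (R : realType) (G : graph) (v : G) : G -> R :=
  fun w => (w == v)%:R.

Definition edge_pt (R : realType) (G : graph) (u v : G) (t : R) : G -> R :=
  fun w => (1 - t) * vertex_pt R u w + t * vertex_pt R v w.

Definition realization (R : realType) (G : graph) : set (G -> R) :=
  [set x | (exists v : G, x = vertex_pt R v) \/
           (exists (u v : G) (t : R),
              [/\ adj u v, 0 <= t <= 1 & x = edge_pt u v t])].
Arguments realization R G : clear implicits.

(* route x l y: y is reached from x, with total length l, by finitely many     *)
(* moves, each inside one closed edge identified isometrically with [0, 1].    *)
Inductive route (R : realType) (G : graph) (x : G -> R) : R -> (G -> R) -> Prop :=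
| route_nil : route x 0 x
| route_step (l : R) (u v : G) (s t : R) :
    adj u v -> 0 <= s <= 1 -> 0 <= t <= 1 ->
    route x l (edge_pt u v s) -> route x (l + `|s - t|) (edge_pt u v t).

(* The value is +oo exactly when x and y lie in different components. *)
Definition graph_dist (R : realType) (G : graph) (x y : G -> R) : \bar R :=
  ereal_inf [set l%:E | l in [set l : R | route x l y]].

Definition diameter (R : realType) (G : graph) : \bar R :=
  ereal_sup [set e | exists x y : G -> R,
    [/\ realization R G x, realization R G y & e = graph_dist x y]].

Definition bounded_graph (R : realType) (G : graph) : Prop :=
  (diameter R G < +oo)%E.

(* Below, a metric space is a subset K of a type X with an extended distance d *)
(* on X, and a geodesic is the image of an isometric embedding of [0, l].      *)
Definition is_geodesic (R : realType) (X : Type) (d : X -> X -> \bar R)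
    (x y : X) (S : set X) : Prop :=
  exists (l : R) (g : R -> X),
    [/\ 0 <= l, g 0 = x, g l = y,
        (forall s t : R, 0 <= s <= l -> 0 <= t <= l ->
           d (g s) (g t) = `|s - t|%:E)
      & S = g @` [set t | 0 <= t <= l]].

Definition geodesic_triangle (R : realType) (X : Type) (d : X -> X -> \bar R)
    (K : set X) (A B C : set X) : Prop :=
  (exists x1 x2 x3 : X,
    [/\ is_geodesic d x1 x2 A, is_geodesic d x2 x3 B & is_geodesic d x3 x1 C])
  /\ [/\ A `<=` K, B `<=` K & C `<=` K].

Definition neighborhood (R : realType) (X : Type) (d : X -> X -> \bar R)
    (delta : R) (S : set X) : set X :=
  [set p | exists2 q, S q & (d p q <= delta%:E)%E].

Definition thin_triangle (R : realType) (X : Type) (d : X -> X -> \bar R)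
    (delta : R) (A B C : set X) : Prop :=
  [/\ A `<=` neighborhood d delta (B `|` C),
      B `<=` neighborhood d delta (C `|` A)
    & C `<=` neighborhood d delta (A `|` B)].

Definition triangle_delta (R : realType) (X : Type) (d : X -> X -> \bar R)
    (A B C : set X) : \bar R :=
  ereal_inf [set delta%:E | delta in
    [set delta : R | 0 <= delta /\ thin_triangle d delta A B C]].

Definition space_delta (R : realType) (X : Type) (d : X -> X -> \bar R)
    (K : set X) : \bar R :=
  ereal_sup [set e | exists A B C : set X,
    geodesic_triangle d K A B C /\ e = triangle_delta d A B C].

Definition component (R : realType) (G : graph) (x : G -> R) : set (G -> R) :=
  [set y | exists l : R, route x l y].

Definition graph_delta (R : realType) (G : graph) : \bar R :=
  ereal_sup [set space_delta (@graph_dist R G) (component x) |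
             x in realization R G].

Definition hyperbolic (R : realType) (G : graph) : Prop :=
  (graph_delta R G < +oo)%E.

(* Main.v *)
(* Without odd cycles, the length of a walk has the parity of the distance
   between its ends, so within a component of G1 x G2 the distance is
   max(d_G1, d_G2), which is within diam G2 of d_G1. The four-point inequality on
   vertices survives such an additive perturbation in both directions (G1 itself
   embeds isometrically in G1 x K2), and for a graph it is equivalent to uniform
   thinness of geodesic triangles, since every point of the realization is at
   distance at most 1 from a vertex. *)

Require Import Defs.
From HB Require Import structures.
From mathcomp Require Import all_boot all_order all_algebra.
From mathcomp Require Import all_classical all_reals all_analysis.
From mathcomp Require Import lra zify.

Set Implicit Arguments.
Unset Strict Implicit.
Unset Printing Implicit Defensive.

Import Order.TTheory GRing.Theory Num.Theory.

Local Open Scope classical_set_scope.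
Local Open Scope ring_scope.

(** * Thin triangles and the four-point inequality *)

Section ThinTriangles.
Variables (R : realType) (X : Type) (d : X -> X -> \bar R).

Lemma thin_triangleS (a b : R) (A B C : set X) :
  a <= b -> thin_triangle d a A B C -> thin_triangle d b A B C.
Proof.
move=> ab [tA tB tC].
have mono S : neighborhood d a S `<=` neighborhood d b S.
  by move=> p [q Sq pq]; exists q => //; apply: le_trans pq _; rewrite lee_fin.
by split; apply: subset_trans (mono _).
Qed.

Lemma thin_of_triangle_delta (e : R) (A B C : set X) :
  (triangle_delta d A B C < e%:E)%E -> thin_triangle d e A B C.
Proof.
move=> /ereal_inf_lt[_ [r [_ tr] <-]]; rewrite lte_fin => re.
by apply: thin_triangleS tr; exact: ltW.
Qed.

(** A discrete form of the connectedness of [0, l]: march from 0 in steps of length e as long as [P]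
    holds. The gap e replaces any closedness assumption on [P] and [Q]. *)
Lemma interval_cover (P Q : R -> Prop) (l e : R) :
    0 <= l -> 0 < e -> P 0 -> Q l -> (forall t, 0 <= t <= l -> P t \/ Q t) ->
  exists s t, [/\ 0 <= s <= l, 0 <= t <= l, P s, Q t & `|s - t| <= e].
Proof.
move=> l0 e0 P0 Ql PQ.
suff step n : forall a, 0 <= a <= l -> P a -> l - a <= n%:R * e ->
    exists s t, [/\ 0 <= s <= l, 0 <= t <= l, P s, Q t & `|s - t| <= e].
  have [n ln] : exists n : nat, l / e < n%:R.
    by exists (Num.truncn (l / e)).+1; apply: truncnS_gt.
  apply: (step n 0) => //; first lra.
  by rewrite subr0; rewrite ltr_pdivrMr // in ln; exact: ltW.
elim: n => [|n IHn] a a0l Pa lan.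
  by exists a, l; split=> //; rewrite ?ler_norml; lra.
have [lae|lae] := leP (l - a) e.
  by exists a, l; split=> //; rewrite ?ler_norml; lra.
have ael : 0 <= a + e <= l by lra.
have [Pm|Qm] := PQ _ ael; last first.
  by exists a, (a + e); split=> //; rewrite ler_norml; lra.
apply: (IHn (a + e)) => //.
by rewrite -natr1 mulrDl mul1r in lan; lra.
Qed.

(** Gromov's four-point condition; the disjunction stands for the maximum of two sums. It is
    relative to a set [V] so that it can be applied to vertices alone. *)
Definition four_point (rho : X -> X -> R) (V : set X) (c : R) : Prop :=
  forall x y z w, V x -> V y -> V z -> V w ->
  rho x z + rho y w <= rho x y + rho z w + c \/
  rho x z + rho y w <= rho x w + rho y z + c.

Variables (K : set X) (rho : X -> X -> R).
Hypothesis dE : forall x y, K x -> K y -> d x y = (rho x y)%:E.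
Hypothesis rhoxx : forall x, K x -> rho x x = 0.
Hypothesis rhoC : forall x y, K x -> K y -> rho x y = rho y x.
Hypothesis rhoT : forall x y z, K x -> K y -> K z -> rho x z <= rho x y + rho y z.

Lemma geodesicP (x y : X) (S : set X) : is_geodesic d x y S -> S `<=` K ->
  0 <= rho x y /\ exists g : R -> X, [/\ g 0 = x, g (rho x y) = y,
    (forall t : R, 0 <= t <= rho x y -> S (g t)),
    (forall s t : R, 0 <= s <= rho x y -> 0 <= t <= rho x y ->
       rho (g s) (g t) = `|s - t|)
  & (forall p, S p -> exists2 t, 0 <= t <= rho x y & p = g t)].
Proof.
move=> [l [g [l0 g0 gl gd SE]]] SK.
have Sg t : 0 <= t <= l -> S (g t) by move=> tl; rewrite SE; exists t.
have Kg t : 0 <= t <= l -> K (g t) by move=> /Sg/SK.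
have gr s t : 0 <= s <= l -> 0 <= t <= l -> rho (g s) (g t) = `|s - t|.
  by move=> sl tl; have := gd s t sl tl; rewrite dE; [case|exact: Kg|exact: Kg].
have -> : rho x y = l.
  by rewrite -g0 -gl gr ?lexx ?l0 // sub0r normrN ger0_norm.
by split=> //; exists g; split=> // p; rewrite SE => -[t /= tl <-]; exists t.
Qed.

Lemma geodesic_ends (x y : X) (S : set X) : is_geodesic d x y S -> S x /\ S y.
Proof.
move=> [l [g [l0 g0 gl _ ->]]].
by split; [exists 0 => //=|exists l => //=]; rewrite ?lexx ?l0.
Qed.

Lemma geodesic_between (x y p : X) (S : set X) : is_geodesic d x y S -> S `<=` K ->
  S p -> rho x p + rho p y = rho x y.
Proof.
move=> gS SK Sp; have [l0 [g [g0 gl _ gr /(_ _ Sp)[t tl ->]]]] := geodesicP gS SK.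
rewrite -{1}g0 -{1}gl !gr ?lexx ?l0 //.
by rewrite sub0r normrN distrC !ger0_norm; lra.
Qed.

(* The point q of [x, z] at distance (p|z)_x from x satisfies
   d(p, q) <= (x|z)_p + c by the four-point inequality for x, p, z, q. *)
Lemma four_point_near_side (c : R) (x z p : X) (S : set X) : four_point rho K c ->
    is_geodesic d x z S -> S `<=` K -> K p ->
  exists2 q, S q & rho p q <= (rho p x + rho p z - rho x z) / 2 + c.
Proof.
move=> fp gS SK Kp; have [l0 [g [g0 gl Sg gr _]]] := geodesicP gS SK.
have [/SK Kx /SK Kz] := geodesic_ends gS.
have h1 := rhoT Kx Kz Kp; have h2 := rhoT Kx Kp Kz; have h3 := rhoT Kp Kx Kz.
rewrite (rhoC Kx Kp) (rhoC Kz Kp) in h1 h2.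
pose t := (rho p x + rho x z - rho p z) / 2.
have tl : 0 <= t <= rho x z by rewrite /t; lra.
have Kq := SK _ (Sg _ tl).
exists (g t); first exact: Sg.
have xq : rho x (g t) = t.
  by rewrite -{1}g0 gr ?lexx ?l0 // sub0r normrN ger0_norm //; lra.
have qz : rho (g t) z = rho x z - t.
  by rewrite -{1}gl gr ?lexx ?l0 // distrC ger0_norm //; lra.
have := fp x p z (g t) Kx Kp Kz Kq.
rewrite (rhoC Kz Kq) (rhoC Kx Kp) qz xq /t.
by case; lra.
Qed.

(** For p on [x, y] one has d(x, y) = d(x, p) + d(p, y), so the four-point inequality for x, p, y, z
    bounds (y|z)_p or (x|z)_p by c / 2. The bound of [four_point_near_side] for the corresponding
    side is then c / 2 + c. *)
Lemma four_point_side (c : R) (x y z : X) (A B C : set X) : four_point rho K c ->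
    is_geodesic d x y A -> is_geodesic d y z B -> is_geodesic d z x C ->
    A `<=` K -> B `<=` K -> C `<=` K ->
  A `<=` neighborhood d (3 / 2 * c) (B `|` C).
Proof.
move=> fp gA gB gC AK BK CK p Ap; have Kp := AK _ Ap.
have [/AK Kx /AK Ky] := geodesic_ends gA; have [_ /BK Kz] := geodesic_ends gB.
have xpy := geodesic_between gA AK Ap.
have := fp x p y z Kx Kp Ky Kz.
have [q1 Bq1 h1] := four_point_near_side fp gB BK Kp.
have [q2 Cq2 h2] := four_point_near_side fp gC CK Kp.
rewrite (rhoC Kx Kp) (rhoC Kz Kx) in xpy h2 *.
case=> h; [exists q1; [by left|]|exists q2; [by right|]].
- by rewrite dE ?lee_fin//; [lra|exact: BK].
- by rewrite dE ?lee_fin//; [lra|exact: CK].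
Qed.

Lemma four_point_thin (c : R) (A B C : set X) : four_point rho K c ->
  geodesic_triangle d K A B C -> thin_triangle d (3 / 2 * c) A B C.
Proof.
move=> fp [[x1 [x2 [x3 [gA gB gC]]]] [AK BK CK]].
split; [exact: (four_point_side fp gA gB gC)|exact: (four_point_side fp gB gC gA)|].
exact: (four_point_side fp gC gA gB).
Qed.

Lemma near_geodesic (e : R) (x y q r : X) (S : set X) : is_geodesic d x y S ->
    S `<=` K -> K q -> S r -> rho q r <= e ->
  rho x q + rho q y <= rho x y + 2 * e.
Proof.
move=> gS SK Kq Sr qr; have Kr := SK _ Sr.
have [/SK Kx /SK Ky] := geodesic_ends gS.
have := geodesic_between gS SK Sr.
have := rhoT Kx Kr Kq; have := rhoT Kq Kr Ky; rewrite (rhoC Kr Kq); lra.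
Qed.

Lemma gromov_product_le (x y r p : X) (S : set X) : is_geodesic d x y S ->
    S `<=` K -> S r -> K p ->
  rho p x + rho p y - rho x y <= 2 * rho p r.
Proof.
move=> gS SK Sr Kp; have Kr := SK _ Sr.
have [/SK Kx /SK Ky] := geodesic_ends gS.
have := geodesic_between gS SK Sr.
have := rhoT Kp Kr Kx; have := rhoT Kp Kr Ky; rewrite (rhoC Kr Kx); lra.
Qed.

(** Up to an additive constant, d(p, [x, z]) is at most (x|z)_p. By [interval_cover] with gap 1,
    some q in [A] is within e of [C] and within e + 1 of [B]. The detours through q from p to x and
    from z to p then cost at most 2e and 2e + 2; add them up. *)
Lemma thin_center (e : R) (x z p : X) (A B C : set X) : 0 <= e ->
    is_geodesic d x z A -> is_geodesic d z p B -> is_geodesic d p x C ->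
    A `<=` K -> B `<=` K -> C `<=` K -> thin_triangle d e A B C ->
  exists2 q, A q & 2 * rho p q <= rho p x + rho p z - rho x z + 4 * e + 2.
Proof.
move=> e0 gA gB gC AK BK CK [tA _ _].
have [l0 [g [g0 gl Ag gr _]]] := geodesicP gA AK.
have [Cp Cx] := geodesic_ends gC; have [Bz Bp] := geodesic_ends gB.
have [Kp Kx Kz] : [/\ K p, K x & K z] by split; [exact: CK|exact: CK|exact: BK].
pose near_side S t := exists2 r, S r & rho (g t) r <= e.
have [|||s [t [sl tl [r Cr sr] [r' Br' tr'] st]]] :=
    @interval_cover (near_side C) (near_side B) _ 1 l0 ltr01.
- by exists x; rewrite // g0 rhoxx.
- by exists z; rewrite // gl rhoxx.
- move=> t tl; have Kt := AK _ (Ag _ tl); have [r [Br|Cr] tr] := tA _ (Ag _ tl).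
  + by right; exists r => //; rewrite dE ?lee_fin // in tr; exact: BK.
  + by left; exists r => //; rewrite dE ?lee_fin // in tr; exact: CK.
have [As At] := (Ag _ sl, Ag _ tl); have [Ks Kt] := (AK _ As, AK _ At).
have Kr' := BK _ Br'.
exists (g s) => //.
have sr' : rho (g s) r' <= e + 1.
  by apply: le_trans (rhoT Ks Kt Kr') _; rewrite gr //; lra.
have := near_geodesic gC CK Ks Cr sr.
have := near_geodesic gB BK Ks Br' sr'.
have := geodesic_between gA AK As.
rewrite (rhoC Kz Ks) (rhoC Kz Kp) (rhoC Kx Ks) (rhoC Ks Kp); lra.
Qed.

(** Take q on [x, z] with d(p, q) <= (x|z)_p + 2e + 1. Thinness of the triangle x, z, y gives r
    within e of q on [z, y] or [y, x], so (z|y)_p or (y|x)_p is at most d(p, r) <= (x|z)_p + 3e + 1.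
    Doubling yields the constant 6e + 2. *)
Lemma thin_four_point (V : set X) (e : R) : 0 <= e -> V `<=` K ->
    (forall x y, V x -> V y -> exists2 S, is_geodesic d x y S & S `<=` K) ->
    (forall A B C, geodesic_triangle d K A B C -> thin_triangle d e A B C) ->
  four_point rho V (6 * e + 2).
Proof.
move=> e0 VK geo thin x y z p Vx Vy Vz Vp.
have [A gA AK] := geo _ _ Vx Vz.
have [B gB BK] := geo _ _ Vz Vp; have [C gC CK] := geo _ _ Vp Vx.
have [B' gB' BK'] := geo _ _ Vz Vy; have [C' gC' CK'] := geo _ _ Vy Vx.
have [Kx Ky Kz Kp] : [/\ K x, K y, K z & K p] by split; exact: VK.
have tABC : thin_triangle d e A B C by apply: thin; split=> //; exists x, z, p.
have [tA _ _] : thin_triangle d e A B' C' by apply: thin; split=> //; exists x, z, y.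
have [q Aq pq] := thin_center e0 gA gB gC AK BK CK tABC.
have Kq := AK _ Aq.
have xp := rhoC Kx Kp; have zp := rhoC Kz Kp; have yp := rhoC Ky Kp.
have yx := rhoC Ky Kx; have zy := rhoC Kz Ky.
have [r [Br|Cr] qr] := tA _ Aq.
- have Kr := BK' _ Br; rewrite dE // lee_fin in qr.
  have := gromov_product_le gB' BK' Br Kp; have := rhoT Kp Kq Kr.
  by right; lra.
- have Kr := CK' _ Cr; rewrite dE // lee_fin in qr.
  have := gromov_product_le gC' CK' Cr Kp; have := rhoT Kp Kq Kr.
  by left; lra.
Qed.

End ThinTriangles.

(** * Walks and their parity in graphs without odd cycles *)

Inductive walk (G : graph) (u : G) : nat -> G -> Prop :=
| walk0 : walk u 0 u
| walkS n v w : walk u n v -> adj v w -> walk u n.+1 w.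

Section Walks.
Variable G : graph.
Implicit Types (u v w : G) (m n : nat).

Lemma walk_cat u v w m n : walk u m v -> walk v n w -> walk u (m + n) w.
Proof.
move=> uv; elim=> [|k x y _ IH xy]; first by rewrite addn0.
by rewrite addnS; exact: walkS IH xy.
Qed.

Lemma walk1 u v : adj u v -> walk u 1 v.
Proof. by move=> uv; exact: walkS (walk0 u) uv. Qed.

Lemma walk_sym u v n : walk u n v -> walk v n u.
Proof.
elim=> [|k x y _ IH xy]; first exact: walk0.
by rewrite -add1n; apply: walk_cat IH; apply: walk1; rewrite adj_sym.
Qed.

Lemma path_walk u (p : seq G) : path (@adj G) u p -> walk u (size p) (last u p).
Proof.
elim/last_ind: p => [|p x IH]; first by move=> _; exact: walk0.
by rewrite rcons_path size_rcons last_rcons => /andP[/IH up px]; exact: walkS px.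
Qed.

Lemma walk_path u v n : walk u n v ->
  exists p : seq G, [/\ path (@adj G) u p, last u p = v & size p = n].
Proof.
elim=> [|k x y _ [p [up px pk]] xy]; first by exists [::].
by exists (rcons p y); rewrite rcons_path last_rcons size_rcons up px pk.
Qed.

Lemma connected_walk u v : connected_graph G -> exists n, walk u n v.
Proof. by move=> /(_ u v)[p [/path_walk up <-]]; exists (size p). Qed.

(** Go back and forth k times along the edge [u, w] before starting. *)
Lemma walk_pad u v w n k : walk u n v -> adj u w -> walk u (k.*2 + n) v.
Proof.
move=> uv uw; elim: k => [//|k IH].
rewrite doubleS !addSn -(addn2 (_ + _)) addnC.
by apply: walk_cat IH; apply: walkS (walk1 uw) _; rewrite adj_sym.
Qed.

Lemma walk_pad_to u v w m n : walk u m v -> adj u w -> (m <= n)%N ->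
  odd m = odd n -> walk u n v.
Proof.
move=> uv uw mn oddmn; suff <- : ((n - m)./2.*2 + m)%N = n by exact: walk_pad uw.
lia.
Qed.

Lemma repeated_vertex (c : seq G) : ~~ uniq c ->
  exists x p1 p2 p3, c = p1 ++ (x :: p2) ++ x :: p3.
Proof.
elim: c => [//|y s IH] /=; rewrite negb_and negbK => /orP[|/IH].
  by case/splitPr => p2 p3; exists y, [::], p2, p3.
by move=> [x [p1 [p2 [p3 ->]]]]; exists x, (y :: p1), p2, p3.
Qed.

(** Strong induction on the length: a closed walk with a repeated vertex splits there into two
    shorter closed walks. Without repetition it is a genuine cycle, or has length at most 2, where
    length 1 would be a loop. *)
Lemma cycle_even (c : seq G) : no_odd_cycle G -> cycle (@adj G) c -> ~~ odd (size c).
Proof.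
move=> noodd; have [n] := ubnP (size c); elim: n c => [//|n IHn] c cn cyc.
have [Uc|/repeated_vertex[x [p1 [p2 [p3 cE]]]]] := boolP (uniq c).
  have [c2|c2] := ltnP 2 (size c); first by apply: noodd; split=> //; apply/andP.
  by case: c cyc c2 {Uc cn} => [|x [|y [|z c]]] //=; rewrite adj_irrefl.
have sz : size c = (size (x :: p2) + size (x :: p3 ++ p1))%N.
  by rewrite cE !size_cat /= !size_cat; lia.
(* Rotated to start at x, the closed walk falls apart into x :: p2 and x :: p3 ++ p1. *)
have : cycle (@adj G) (x :: p2 ++ x :: p3 ++ p1).
  by rewrite cE cycle_catC /= -catA in cyc.
rewrite /= rcons_cat cat_path /= => /and3P[xp2 p2x xq].
rewrite sz oddD (negPf (IHn (x :: p2) _ _)) //=; last by rewrite rcons_path xp2.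
  by apply: (IHn (x :: p3 ++ p1)) => //; move: cn; rewrite sz /=; lia.
by move: cn; rewrite sz /=; lia.
Qed.

Lemma closed_walk_even u n : no_odd_cycle G -> walk u n u -> ~~ odd n.
Proof.
move=> noodd /walk_path[[|x p] [pth lst <-]] //.
have := @cycle_even (belast u (x :: p)) noodd; rewrite size_belast; apply.
by rewrite /= -[X in rcons _ X]lst -lastI.
Qed.

(** One walk followed by the reverse of the other is closed. *)
Lemma walk_parity u v m n : no_odd_cycle G -> walk u m v -> walk u n v ->
  odd m = odd n.
Proof.
move=> noodd um /walk_sym un.
by have := closed_walk_even noodd (walk_cat um un); rewrite oddD negb_add => /eqP.
Qed.

End Walks.

(** * Routes, distances and geodesics in the metric graph *)

Section Realization.
Variables (R : realType) (G : graph).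
Implicit Types (u v w : G) (x y z : G -> R).

Lemma edge_pt0 u v : edge_pt u v (0 : R) = vertex_pt R u.
Proof. by apply/funext => w; rewrite /edge_pt subr0 mul1r mul0r addr0. Qed.

Lemma edge_pt1 u v : edge_pt u v (1 : R) = vertex_pt R v.
Proof. by apply/funext => w; rewrite /edge_pt subrr mul0r mul1r add0r. Qed.

Lemma route_ge0 x y (l : R) : route x l y -> 0 <= l.
Proof. by elim=> // *; apply: addr_ge0. Qed.

Lemma route_trans x y z (l m : R) : route x l y -> route y m z -> route x (l + m) z.
Proof.
move=> xy; elim=> [|k u v s t uv s01 t01 _ IH]; first by rewrite addr0.
by rewrite addrA; exact: route_step IH.
Qed.

Lemma route_edge u v (s t : R) : adj u v -> 0 <= s <= 1 -> 0 <= t <= 1 ->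
  route (edge_pt u v s) `|s - t| (edge_pt u v t).
Proof.
by move=> uv s01 t01; rewrite -[`|_|]add0r; apply: route_step => //; exact: route_nil.
Qed.

Lemma route_sym x y (l : R) : route x l y -> route y l x.
Proof.
elim=> [|k u v s t uv s01 t01 _ IH]; first exact: route_nil.
by rewrite addrC distrC; apply: route_trans IH; exact: route_edge.
Qed.

Lemma route_adj u v : adj u v -> route (vertex_pt R u) 1 (vertex_pt R v).
Proof.
move=> uv; have := @route_edge u v 0 1 uv.
by rewrite edge_pt0 edge_pt1 sub0r normrN1; apply; rewrite ?lexx ?ler01.
Qed.

Lemma walk_route u v n : walk u n v -> route (vertex_pt R u) n%:R (vertex_pt R v).
Proof.
elim=> [|k x y _ IH /route_adj xy]; first exact: route_nil.
by rewrite -natr1; exact: route_trans xy.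
Qed.

Lemma vertex_ptE u v : vertex_pt R u v = (v == u)%:R. Proof. by []. Qed.

Lemma edge_ptl u v (t : R) : adj u v -> edge_pt u v t u = 1 - t.
Proof.
move=> uv; rewrite /edge_pt !vertex_ptE eqxx.
have -> : (u == v) = false by apply/eqP => E; rewrite E adj_irrefl in uv.
by rewrite mulr1 mulr0 addr0.
Qed.

Lemma edge_ptr u v (t : R) : adj u v -> edge_pt u v t v = t.
Proof.
move=> uv; rewrite /edge_pt !vertex_ptE eqxx.
have -> : (v == u) = false by apply/eqP => E; rewrite E adj_irrefl in uv.
by rewrite mulr1 mulr0 add0r.
Qed.

Lemma edge_pt_supp u v w (t : R) : edge_pt u v t w != 0 -> w = u \/ w = v.
Proof.
rewrite /edge_pt !vertex_ptE; have [->|_] := eqVneq w u; first by left.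
by have [->|_] := eqVneq w v; [right|rewrite !mulr0 addr0 eqxx].
Qed.

(* A point y is at distance 1 - y a from each vertex a of its support, so a
   route from u to y of length l passes, at distance l - (1 - y a), through
   such a vertex a; stating this with barycentric coordinates makes it
   independent of the edge that represents y. *)
Lemma route_through_vertex u y (l : R) : route (vertex_pt R u) l y ->
  exists n a, [/\ walk u n a, 0 < y a & n%:R + (1 - y a) <= l].
Proof.
elim=> [|k p q s t pq s01 t01 _ [n [a [un ya nk]]]].
  by exists 0%N, u; rewrite vertex_ptE eqxx subrr addr0; split=> //; exact: walk0.
have st : s - t <= `|s - t| by exact: ler_norm.
have ts : t - s <= `|s - t| by rewrite distrC; exact: ler_norm.
have /edge_pt_supp[aE|aE] : edge_pt p q s a != 0 by rewrite gt_eqF.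
- rewrite aE edge_ptl // in un ya nk.
  (* While t < 1 the vertex p stays in the support; t = 1 is the vertex q itself, and the walk gains
     the edge [p, q]. *)
  have [t1|t1] := ltP t 1; first by exists n, p; rewrite edge_ptl //; split=> //; lra.
  exists n.+1, q; rewrite edge_ptr // -natr1; split; [exact: walkS pq|lra|lra].
- rewrite aE edge_ptr // in un ya nk.
  have [t0|t0] := ltP 0 t; first by exists n, q; rewrite edge_ptr //; split=> //; lra.
  exists n.+1, p; rewrite edge_ptl // -natr1; split; [|lra|lra].
  by apply: walkS un _; rewrite adj_sym.
Qed.

(** The support of the vertex v is v alone, with coordinate 1, so the correction 1 - y a in
    [route_through_vertex] vanishes. *)
Lemma route_walk u v (l : R) : route (vertex_pt R u) l (vertex_pt R v) ->
  exists2 n, walk u n v & n%:R <= l.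
Proof.
move=> /route_through_vertex[n [a []]]; rewrite vertex_ptE.
by have [-> un _|_ _] := eqVneq a v; [rewrite subrr addr0; exists n|rewrite ltxx].
Qed.

Lemma vertex_near x : realization R G x ->
  exists v (l : R), l <= 1 /\ route x l (vertex_pt R v).
Proof.
move=> [[v ->]|[u [v [t [uv t01 ->]]]]]; first by exists v, 0; split=> //; exact: route_nil.
exists u, `|t - 0|; split; first by rewrite subr0 ger0_norm; lra.
by rewrite -(edge_pt0 u v); apply: route_edge; rewrite ?lexx ?ler01.
Qed.

Lemma realization_route x y (l : R) : realization R G x -> route x l y ->
  realization R G y.
Proof. by move=> Rx; case=> // k u v s t uv _ t01 _; right; exists u, v, t. Qed.

(** Points in different components get the default value 0 of [fine] at +oo; the link with
    [graph_dist] is therefore always made through a route. *)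
Definition rdist x y : R := fine (graph_dist x y).

Lemma graph_dist_ge0 x y : (0 <= graph_dist x y)%E.
Proof.
by apply: le_ereal_inf_tmp => _ [l /route_ge0 l0 <-]; rewrite lee_fin.
Qed.

Lemma graph_dist_le x y (l : R) : route x l y -> (graph_dist x y <= l%:E)%E.
Proof. by move=> xy; apply: ereal_inf_lbound; exists l. Qed.

Lemma graph_distE x y (l : R) : route x l y -> graph_dist x y = (rdist x y)%:E.
Proof.
move=> /graph_dist_le xyl; rewrite /rdist fineK // ge0_fin_numE ?graph_dist_ge0 //.
exact: le_lt_trans xyl (ltry _).
Qed.

Lemma rdist_le x y (l : R) : route x l y -> rdist x y <= l.
Proof. by move=> xy; rewrite -lee_fin -(graph_distE xy); exact: graph_dist_le. Qed.

Lemma rdist_approx x y (l e : R) : route x l y -> 0 < e ->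
  exists2 m, route x m y & m < rdist x y + e.
Proof.
move=> xy e0.
have : (graph_dist x y < (rdist x y + e)%:E)%E.
  by rewrite (graph_distE xy) lte_fin ltrDl.
by move=> /ereal_inf_lt[_ [m xm <-]]; rewrite lte_fin; exists m.
Qed.

Lemma rdistC x y : rdist x y = rdist y x.
Proof.
rewrite /rdist /graph_dist; congr (fine (ereal_inf (_ @` _))).
by apply/seteqP; split=> l /= /route_sym.
Qed.

Lemma rdist_ge0 x y : 0 <= rdist x y.
Proof. by rewrite fine_ge0 ?graph_dist_ge0. Qed.

Lemma rdistxx x : rdist x x = 0.
Proof. by apply/eqP; rewrite eq_le rdist_ge0 andbT; apply/rdist_le/route_nil. Qed.

Lemma rdist_triangle x y z (l m : R) : route x l y -> route y m z ->
  rdist x z <= rdist x y + rdist y z.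
Proof.
move=> xy yz; apply/ler_addgt0Pr => e e0.
have e2 : 0 < e / 2 by lra.
have [l' xy' l'e] := rdist_approx xy e2; have [m' yz' m'e] := rdist_approx yz e2.
have := rdist_le (route_trans xy' yz'); lra.
Qed.

Lemma rdist_walk_le u v n : walk u n v -> rdist (vertex_pt R u) (vertex_pt R v) <= n%:R.
Proof. by move=> /walk_route; exact: rdist_le. Qed.

(** The infimum is attained by a shortest walk: a route of length below distance + e yields a walk
    no longer than it, for every e > 0. *)
Lemma rdist_walk u v m : walk u m v ->
  exists2 n, walk u n v & rdist (vertex_pt R u) (vertex_pt R v) = n%:R.
Proof.
move=> um; have uv : exists n, `[< walk u n v >] by exists m; apply/asboolP.
exists (ex_minn uv); case: ex_minnP => n /asboolP un nmin //.
apply/eqP; rewrite eq_le rdist_walk_le //=; apply/ler_addgt0Pr => e e0.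
have [l /route_walk[k uk kl] le] := rdist_approx (walk_route um) e0.
have : (n%:R : R) <= k%:R by rewrite ler_nat; apply: nmin; apply/asboolP.
lra.
Qed.

Lemma walk_parametrization u v n : walk u n v ->
  exists g : R -> G -> R, [/\ g 0 = vertex_pt R u, g n%:R = vertex_pt R v
    & forall s t, 0 <= s -> s <= t -> t <= n%:R -> route (g s) (t - s) (g t)].
Proof.
elim=> [|k p q _ [g [g0 gk gr]] pq].
  exists (fun=> vertex_pt R u); split=> // s t s0 st t0.
  have -> : t - s = 0 by lra.
  exact: route_nil.
exists (fun t => if t <= k%:R then g t else edge_pt p q (t - k%:R)).
rewrite ler0n -natr1 gerDl ler10 addrC addKr edge_pt1; split=> // s t s0 st tk.
have [tk'|tk'] := leP t k%:R; first by rewrite (le_trans st tk'); exact: gr.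
have [sk|sk] := leP s k%:R.
  have -> : t - s = (k%:R - s) + `|0 - (t - k%:R)|.
    by rewrite sub0r normrN ger0_norm; lra.
  apply: route_step => //; [by rewrite lexx ler01|lra|].
  by rewrite edge_pt0 -gk; exact: gr.
have -> : t - s = `|(s - k%:R) - (t - k%:R)| by rewrite distrC ger0_norm; lra.
by apply: route_edge => //; lra.
Qed.

(** Follow a shortest walk at unit speed. The routes give d(g s, g t) <= t - s, and a strict
    inequality would make the ends closer than m, by the triangle inequality. *)
Lemma vertex_geodesic u v n : walk u n v ->
  exists2 S, is_geodesic (@graph_dist R G) (vertex_pt R u) (vertex_pt R v) S
    & S `<=` component (vertex_pt R u).
Proof.
move=> /rdist_walk[m um dm]; have [g [g0 gm gr]] := walk_parametrization um.
have m0 : 0 <= m%:R :> R by exact: ler0n.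
exists (g @` [set t | 0 <= t <= m%:R]); last first.
  move=> _ [t /= /andP[t0 tm] <-]; exists (t - 0); rewrite -g0.
  exact: gr (lexx 0) t0 tm.
exists m%:R, g; split=> //.
have dist_le s t : 0 <= s -> s <= t -> t <= m%:R -> graph_dist (g s) (g t) = (t - s)%:E.
  move=> s0 st tm.
  have r0s : route (g 0) (s - 0) (g s) by apply: gr => //; lra.
  have rtm : route (g t) (m%:R - t) (g m%:R) by apply: gr => //; lra.
  have rst := gr _ _ s0 st tm.
  rewrite (graph_distE rst); congr (_%:E).
  have := rdist_triangle r0s (route_trans rst rtm).
  have := rdist_triangle rst rtm.
  have := rdist_le rst; have := rdist_le r0s; have := rdist_le rtm.
  rewrite g0 gm dm; lra.
move=> s t /andP[s0 sm] /andP[t0 tm]; have [st|/ltW ts] := leP s t.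
  by rewrite dist_le // distrC ger0_norm //; lra.
have r := gr _ _ t0 ts sm.
by rewrite (graph_distE (route_sym r)) rdistC -(graph_distE r) dist_le // ger0_norm //; lra.
Qed.

End Realization.

(** * Hyperbolicity as a four-point inequality on vertices *)

Section FourPointGraph.
Variables (R : realType) (G : graph).
Implicit Types (u v w : G) (x y z : G -> R).

Lemma hyperbolic_thinP : hyperbolic R G <->
  exists2 e : R, 0 <= e & forall x, realization R G x -> forall A B C,
    geodesic_triangle (@graph_dist R G) (component x) A B C ->
    thin_triangle (@graph_dist R G) e A B C.
Proof.
split=> [hypG|[e e0 thin]]; last first.
  apply: (@le_lt_trans _ _ e%:E); last exact: ltry.
  apply: ge_ereal_sup => _ [x Rx <-]; apply: ge_ereal_sup => _ [A [B [C [tABC ->]]]].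
  by apply: ereal_inf_lbound; exists e => //; split=> //; exact: thin tABC.
(* M is strictly above the supremum, since the infimum defining [triangle_delta] need not be
   attained. Nothing here keeps M nonnegative, hence the maximum with 0 below. *)
have [M ltM] : exists M : R, (graph_delta R G < M%:E)%E.
  move: hypG; rewrite /hyperbolic; case: graph_delta => [r| |] // _.
    by exists (r + 1); rewrite lte_fin ltrDl.
  by exists 0; exact: ltNyr.
exists (Num.max 0 M) => [|x Rx A B C tABC]; first by rewrite le_max lexx.
apply: (@thin_triangleS _ _ _ M); first by rewrite le_max lexx orbT.
apply/thin_of_triangle_delta/le_lt_trans/ltM.
apply: (@le_trans _ _ (space_delta (@graph_dist R G) (component x))).
  by apply: ereal_sup_ubound; exists A, B, C.
by apply: ereal_sup_ubound; exists x.
Qed.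

Definition vertex_dist u v : R := rdist (vertex_pt R u) (vertex_pt R v).

Definition reachable u : set G := [set v | exists n, walk u n v].

Lemma reachable_walk u v w : reachable u v -> reachable u w -> exists n, walk v n w.
Proof. by move=> [m /walk_sym vu] [n uw]; exists (m + n)%N; exact: walk_cat vu uw. Qed.

Lemma component_route x y z : component x y -> component x z ->
  exists l : R, route y l z.
Proof.
by move=> [l xy] [m xz]; exists (l + m); exact: route_trans (route_sym xy) xz.
Qed.

Lemma component_graph_distE x y z : component x y -> component x z ->
  graph_dist y z = (rdist y z)%:E.
Proof. by move=> xy xz; have [l /graph_distE] := component_route xy xz. Qed.

Lemma component_rdist_triangle x y z (w : G -> R) : component x y -> component x z ->
  component x w -> rdist y w <= rdist y z + rdist z w.
Proof.
move=> xy xz xw; have [l yz] := component_route xy xz.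
by have [m zw] := component_route xz xw; exact: rdist_triangle yz zw.
Qed.

Lemma hyperbolic_four_point : hyperbolic R G ->
  exists c, forall u, four_point vertex_dist (reachable u) c.
Proof.
move=> /hyperbolic_thinP[e e0 thin]; exists (6 * e + 2) => u.
have Rv v : realization R G (vertex_pt R v) by left; exists v.
have VK : (@vertex_pt R G) @` reachable u `<=` component (vertex_pt R u).
  by move=> _ [v [n /walk_route uv] <-]; exists n%:R.
have /= fp := thin_four_point (@component_graph_distE (vertex_pt R u))
  (fun y _ => rdistxx y) (fun y z _ _ => rdistC y z)
  (@component_rdist_triangle (vertex_pt R u)) e0 VK _ (thin _ (Rv u)).
move=> x y z w Vx Vy Vz Vw.
apply: fp; try by apply: imageP.
move=> _ _ [v uv <-] [v' uv' <-]; have [n vv'] := reachable_walk uv uv'.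
have [S gS SK] := vertex_geodesic R vv'; exists S => // p /SK[l vp].
by case: uv => m /(walk_route R) um; exists (m%:R + l); exact: route_trans um vp.
Qed.

(** Moving each of four points to a vertex at distance at most 1 changes every distance by at most
    2. Each side of the inequality has two distances, so the constant grows by 8; [four_point_thin]
    brings the factor 3 / 2. *)
Lemma four_point_hyperbolic (c : R) :
  (forall u, four_point vertex_dist (reachable u) c) -> hyperbolic R G.
Proof.
move=> fp; apply/hyperbolic_thinP; exists (Num.max 0 (3 / 2 * (c + 8))).
  by rewrite le_max lexx.
move=> x Rx A B C tABC.
apply: (@thin_triangleS _ _ _ (3 / 2 * (c + 8))); first by rewrite le_max lexx orbT.
apply: (four_point_thin (@component_graph_distE x) (fun y z _ _ => rdistC y z)
  (@component_rdist_triangle x) _ tABC).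
have [u [l [_ xu]]] := vertex_near Rx.
have near y : component x y -> exists v, [/\ reachable u v,
    component x (vertex_pt R v) & rdist y (vertex_pt R v) <= 1].
  move=> [m xy]; have [v [k [k1 yv]]] := vertex_near (realization_route Rx xy).
  have xv := route_trans xy yv.
  have [n uv _] := route_walk (route_trans (route_sym xu) xv).
  exists v; split; [by exists n|by exists (m + k)|].
  exact: le_trans (rdist_le yv) k1.
have close y z v w : component x y -> component x z ->
    component x (vertex_pt R v) -> component x (vertex_pt R w) ->
    rdist y (vertex_pt R v) <= 1 -> rdist z (vertex_pt R w) <= 1 ->
    `|rdist y z - vertex_dist v w| <= 2.
  move=> Ky Kz Kv Kw yv zw; rewrite ler_norml /vertex_dist.
  have T := @component_rdist_triangle x.
  have := T _ _ _ Ky Kv Kz; have := T _ _ _ Kv Kw Kz.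
  have := T _ _ _ Kv Ky Kw; have := T _ _ _ Ky Kz Kw.
  by rewrite (rdistC (vertex_pt R v) y) (rdistC (vertex_pt R w) z); lra.
move=> y1 y2 y3 y4 K1 K2 K3 K4.
have [[v1 [V1 Kv1 d1]] [v2 [V2 Kv2 d2]]] := (near _ K1, near _ K2).
have [[v3 [V3 Kv3 d3]] [v4 [V4 Kv4 d4]]] := (near _ K3, near _ K4).
have := close _ _ _ _ K1 K3 Kv1 Kv3 d1 d3.
have := close _ _ _ _ K2 K4 Kv2 Kv4 d2 d4.
have := close _ _ _ _ K1 K2 Kv1 Kv2 d1 d2.
have := close _ _ _ _ K3 K4 Kv3 Kv4 d3 d4.
have := close _ _ _ _ K1 K4 Kv1 Kv4 d1 d4.
have := close _ _ _ _ K2 K3 Kv2 Kv3 d2 d3.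
rewrite !ler_norml.
by case: (fp u v1 v2 v3 v4 V1 V2 V3 V4) => h *; [left|right]; lra.
Qed.

End FourPointGraph.

(** * Distances in the direct product and transfer of hyperbolicity *)

Section DirectProduct.
Variables G1 G2 : graph.
Local Notation G12 := (direct_product G1 G2).

Lemma walk_prod (p q : G12) n :
  walk p n q <-> walk p.1 n q.1 /\ walk p.2 n q.2.
Proof.
split=> [|[]].
  elim=> [|k x y _ [IH1 IH2] /andP[xy1 xy2]]; first by split; exact: walk0.
  by split; [exact: walkS xy1|exact: walkS xy2].
case: p => p1 p2; elim: n q => [|n IH] [q1 q2] /= w1 w2.
  by inversion w1; inversion w2; exact: walk0.
inversion w1 as [|n1 x1 y1 px1 xq1]; inversion w2 as [|n2 x2 y2 px2 xq2].
have := IH (x1, x2) px1 px2; move=> /walkS; apply.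
by apply/andP.
Qed.

(** Supplies the edge of [G2] along which walks are padded: a path from v to another vertex starts
    with one. *)
Lemma nontrivial_neighbor (v : G2) : connected_graph G2 -> ~ trivial_graph G2 ->
  exists w, adj v w.
Proof.
move=> conn nontriv; apply: contrapT => noadj; apply: nontriv; exists v => w.
have [[|x p] [/= pth lst]] := conn v w; first by [].
by case/andP: pth => vx _; case: noadj; exists x.
Qed.

Lemma bounded_vertex_dist (R : realType) : bounded_graph R G2 ->
  connected_graph G2 -> exists D : R, forall u v : G2, vertex_dist R u v <= D.
Proof.
rewrite /bounded_graph => bnd conn.
have distE (u v : G2) : graph_dist (vertex_pt R u) (vertex_pt R v) = (vertex_dist R u v)%:E.
  by have [n /(walk_route R)/graph_distE] := connected_walk u v conn.
have le_diam (u v : G2) : ((vertex_dist R u v)%:E <= diameter R G2)%E.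
  rewrite -distE; apply: ereal_sup_ubound.
  by exists (vertex_pt R u), (vertex_pt R v); split=> //; left; [exists u|exists v].
move: bnd le_diam; case: diameter => [D| |] // _ le_diam.
  by exists D => u v; rewrite -lee_fin.
(* Diameter -oo: [le_diam] would put a real number below -oo. *)
by exists 0 => u v; have := le_diam u v.
Qed.

Variable R : realType.

Lemma vertex_dist_fst_le (p q : G12) n : walk p n q ->
  vertex_dist R p.1 q.1 <= vertex_dist R p q.
Proof.
move=> /(rdist_walk R)[k /walk_prod[pq _]]; rewrite {2}/vertex_dist => ->.
exact: rdist_walk_le.
Qed.

Hypotheses (G1_no_odd : no_odd_cycle G1) (G2_no_odd : no_odd_cycle G2).
Hypothesis G2_neighbor : forall v : G2, exists w, adj v w.

(* Both projections of a walk have the parity of the walk, so the shorter of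
   two shortest walks in the factors can be padded to the length of the other. *)
Lemma vertex_dist_prod_le (D : R) (p q : G12) n : 0 <= D ->
    vertex_dist R p.2 q.2 <= D -> walk p n q ->
  vertex_dist R p q <= vertex_dist R p.1 q.1 + D.
Proof.
move=> D0 le2 /walk_prod[pq1 pq2].
have [m1 w1 E1] := rdist_walk R pq1; have [m2 w2 E2] := rdist_walk R pq2.
rewrite /vertex_dist E1; rewrite /vertex_dist E2 in le2.
have odd1 := walk_parity G1_no_odd w1 pq1; have odd2 := walk_parity G2_no_odd w2 pq2.
have [m21|/ltnW m12] := leqP m2 m1.
  have [w pw] := G2_neighbor p.2.
  have w2' : walk p.2 m1 q.2 by apply: walk_pad_to w2 pw m21 _; rewrite odd1 odd2.
  have := @rdist_walk_le R _ p q m1; rewrite walk_prod => /(_ (conj w1 w2')); lra.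
suff w1' : walk p.1 m2 q.1.
  have := @rdist_walk_le R _ p q m2; rewrite walk_prod => /(_ (conj w1' w2)).
  have : 0 <= m1%:R :> R by exact: ler0n.
  lra.
(* [G1] may be a single vertex, so the edge for padding is the first one of the given walk. If that
   walk has length 0, then m2 = 0, which forces m1 = 0. *)
case: (n) pq1 pq2 odd1 odd2 => [|n'] pq1 pq2 odd1 odd2.
  have E0 : vertex_dist R p.2 q.2 = 0 by inversion pq2; exact: rdistxx.
  have m20 : m2 = 0%N by apply/eqP; rewrite -(eqr_nat R) -E2; apply/eqP.
  by move: m12 w1; rewrite m20 leqn0 => /eqP ->.
have [w pw] : exists w, adj p.1 w.
  by have [[|w s] [//= /andP[pw _] _ _]] := walk_path pq1; exists w.
by apply: walk_pad_to w1 pw m12 _; rewrite odd1 odd2.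
Qed.

(** Passing from [G1] to the product adds between 0 and D to each distance, so the left-hand sum
    grows by at most 2D and the right-hand sums do not shrink. *)
Lemma hyperbolic_prod_of_factor (D : R) :
  (forall u v : G2, vertex_dist R u v <= D) -> hyperbolic R G1 -> hyperbolic R G12.
Proof.
move=> le2 /hyperbolic_four_point[c fp].
apply: (@four_point_hyperbolic _ _ (c + 2 * D)) => p x y z w px py pz pw.
have D0 : 0 <= D := le_trans (rdist_ge0 _ _) (le2 p.2 p.2).
have reach1 q : reachable p q -> reachable p.1 q.1.
  by move=> [n /walk_prod[pq _]]; exists n.
have close q r : reachable p q -> reachable p r ->
    vertex_dist R q.1 r.1 <= vertex_dist R q r <= vertex_dist R q.1 r.1 + D.
  move=> pq pr; have [n qr] := reachable_walk pq pr.
  by rewrite (vertex_dist_fst_le qr) (vertex_dist_prod_le D0 (le2 _ _) qr).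
have /andP[_ xz] := close _ _ px pz; have /andP[_ yw] := close _ _ py pw.
have /andP[xy _] := close _ _ px py; have /andP[zw _] := close _ _ pz pw.
have /andP[xw _] := close _ _ px pw; have /andP[yz _] := close _ _ py pz.
have [h|h] := fp _ _ _ _ _ (reach1 _ px) (reach1 _ py) (reach1 _ pz) (reach1 _ pw).
  by left; lra.
by right; lra.
Qed.

(** The parity of walks from u colours [G1] properly with two colours. Sending the colours to the
    ends of an edge [a, b] of [G2] lifts walks to walks of the same length, while projecting back
    does not increase distances; the constant c is unchanged. *)
Lemma hyperbolic_factor_of_prod (a : G2) : connected_graph G1 ->
  hyperbolic R G12 -> hyperbolic R G1.
Proof.
move=> conn /hyperbolic_four_point[c fp].
apply: (@four_point_hyperbolic _ _ c) => u x y z w ux uy uz uw.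
have [b ab] := G2_neighbor a.
pose col v := `[< exists n, walk u n v /\ odd n >].
have colE n v : walk u n v -> col v = odd n.
  move=> uv; apply/asboolP/idP => [[m [um om]]|]; last by exists n.
  by rewrite (walk_parity G1_no_odd uv um).
(* G1 embeds isometrically in G1 x {a, b}. *)
pose f v : G12 := (v, if col v then b else a).
have f_adj v v' : adj v v' -> adj (f v) (f v').
  move=> vv'; apply/andP; split=> //=; have [n uv] := connected_walk u v conn.
  rewrite (colE _ _ uv) (colE _ _ (walkS uv vv')) /=.
  by case: (odd n) => //=; rewrite adj_sym.
have f_walk n v v' : walk v n v' -> walk (f v) n (f v').
  by elim=> [|k r s _ IH rs]; [exact: walk0|exact: walkS IH (f_adj _ _ rs)].
have f_dist v v' : vertex_dist R (f v) (f v') = vertex_dist R v v'.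
  have [n vv'] := connected_walk v v' conn; have [m vm vE] := rdist_walk R vv'.
  apply/eqP; rewrite eq_le (vertex_dist_fst_le (f_walk _ _ _ vv')) andbT.
  by rewrite /vertex_dist vE; exact/rdist_walk_le/f_walk.
have reach v : reachable u v -> reachable (f u) (f v).
  by move=> [n uv]; exists n; exact: f_walk.
have := fp _ _ _ _ _ (reach _ ux) (reach _ uy) (reach _ uz) (reach _ uw).
by rewrite !f_dist.
Qed.

End DirectProduct.

Theorem theorem2p12 (R : realType) (G1 G2 : graph)
    (G1_nonempty : nonempty_graph G1) (G1_connected : connected_graph G1)
    (G2_nonempty : nonempty_graph G2) (G2_connected : connected_graph G2)
    (G1_no_odd : no_odd_cycle G1)
    (G2_nontrivial : ~ trivial_graph G2) (G2_bounded : bounded_graph R G2)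
    (G2_no_odd : no_odd_cycle G2) :
  hyperbolic R (direct_product G1 G2) <-> hyperbolic R G1.
Proof.
have [a _] := G2_nonempty.
have neighbor v := nontrivial_neighbor v G2_connected G2_nontrivial.
have [D le2] := bounded_vertex_dist G2_bounded G2_connected.
split; first exact: hyperbolic_factor_of_prod.
exact: hyperbolic_prod_of_factor le2.
Qed.
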